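(* Let $X$ be a real Hilbert space, let $L\colon X\to X$ be linear and nonexpansive, let $b\in X$, set $T\colon X\to X\colon x\mapsto Lx+b$, suppose that $\operatorname{Fix}T\neq\varnothing$, and let $\mu\in\,]0,1[$. Then the following are equivalent: (i) $T^n\to P_{\operatorname{Fix}T}$ $\mu$-linearly pointwise (in $X$). (ii) $L^n\to P_{\operatorname{Fix}L}$ $\mu$-linearly pointwise (in $X$). (iii) $L^n\to P_{\operatorname{Fix}L}$ $\mu$-linearly (in $\mathcal B(X)$).
   Context: A map $S\colon X\to X$ is nonexpansive if $\|Sx-Sy\|\le\|x-y\|$ for all $x,y$. $\operatorname{Fix}S=\{x : Sx=x\}$; $P_C$ is the projector onto a nonempty closed convex set $C$. $\mathcal B(X)$ is the Banach space of bounded linear operators on $X$ with the operator norm. In a Banach space, $(y_n)_{n\in\mathbb N}$ converges $\mu$-linearly to $y_\infty$ if there exists $M\ge0$ with $\|y_n-y_\infty\|\le M\mu^n$ for all $n\in\mathbb N$. ''$S_n\to S$ $\mu$-linearly pointwise'' means that for every $x\in X$, $S_nx\to Sx$ $\mu$-linearly (the constant $M$ may depend on $x$). *)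

(* Defs.v *)
From HB Require Import structures.
From mathcomp Require Import all_boot all_order all_algebra.
From mathcomp Require Import all_classical all_reals all_analysis.
Set Implicit Arguments.
Unset Strict Implicit.
Unset Printing Implicit Defensive.
Import Order.TTheory GRing.Theory Num.Theory.
Import numFieldNormedType.Exports.
Local Open Scope classical_set_scope.
Local Open Scope ring_scope.

(* A real Hilbert space is a complete normed module [X] over [R : realType]
   together with an inner product [dot : {dot X for idfun}] (a symmetric,
   positive definite bilinear form) that induces the norm of [X]. *)
Definition induces_norm (R : realType) (X : normedModType R)
    (dot : X -> X -> R) : Prop :=
  forall x, dot x x = `|x| ^+ 2.

Definition nonexpansive (R : realType) (X : normedModType R)
    (S : X -> X) : Prop :=
  forall x y, `|S x - S y| <= `|x - y|.

Definition Fixset (X : Type) (S : X -> X) : set X := [set x | S x = x].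

(* The nearest point of [C] to [x]. In a Hilbert space it exists and is unique
   when [C] is nonempty, closed and convex; the default [x] of [xget] is
   returned only if no nearest point exists. *)
Definition projector (R : realType) (X : normedModType R)
    (C : set X) (x : X) : X :=
  xget x [set p | C p /\ forall y, C y -> `|x - p| <= `|x - y|].

Definition cvg_linearly (R : realType) (Y : normedModType R) (mu : R)
    (y : nat -> Y) (l : Y) : Prop :=
  exists2 M : R, 0 <= M & forall n, `|y n - l| <= M * mu ^+ n.

Definition cvg_linearly_pointwise (R : realType) (X : normedModType R) (mu : R)
    (S_ : nat -> X -> X) (S : X -> X) : Prop :=
  forall x, cvg_linearly mu (fun n => S_ n x) (S x).

Definition bounded_operator (R : realType) (X : normedModType R)
    (A : X -> X) : Prop :=
  linear A /\ exists M : R, forall x, `|A x| <= M * `|x|.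

(* The supremum is meaningful for bounded operators only: [sup] returns 0 on
   sets that are not bounded above. *)
Definition opnorm (R : realType) (X : normedModType R) (A : X -> X) : R :=
  sup [set `|A x| | x in [set x : X | `|x| <= 1]].

(* Linear convergence in the space of bounded linear operators: the terms and
   the limit are required to belong to that space. *)
Definition cvg_linearly_opnorm (R : realType) (X : normedModType R) (mu : R)
    (A_ : nat -> X -> X) (A : X -> X) : Prop :=
  [/\ forall n, bounded_operator (A_ n),
      bounded_operator A &
      exists2 M : R, 0 <= M & forall n, opnorm (A_ n \- A) <= M * mu ^+ n].

(* Main.v *)
Require Import Defs.
From HB Require Import structures.
From mathcomp Require Import all_boot all_order all_algebra.
From mathcomp Require Import all_classical all_reals all_analysis.
From mathcomp Require Import ring lra.
Set Implicit Arguments.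
Unset Strict Implicit.
Unset Printing Implicit Defensive.
Import Order.TTheory GRing.Theory Num.Theory.
Import numFieldNormedType.Exports.
Local Open Scope classical_set_scope.
Local Open Scope ring_scope.

(* For [p] in [Fix T] one has [T^n x - p = L^n (x - p)] and
   [Fix T = p + Fix L], so the nearest-point maps are translates of each other
   and (i) is (ii) read at [x - p]. If (ii) holds, then [P_{Fix L}] is linear
   and nonexpansive as the pointwise limit of the [L^n]; the operators
   [mu^-n (L^n - P_{Fix L})] are pointwise bounded, hence uniformly bounded by
   Banach-Steinhaus, which is (iii). *)

Section NearestPoint.
Variables (R : realType) (X : normedModType R).
Variables (dot : {dot X for idfun}) (dot_norm : induces_norm dot).

(** The inner product enters the whole argument through this identity, which serves to make nearest
    points unique. *)
Lemma parallelogram (x y : X) :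
  `|x + y| ^+ 2 + `|x - y| ^+ 2 = 2 * `|x| ^+ 2 + 2 * `|y| ^+ 2.
Proof using dot dot_norm.
rewrite -!dot_norm !(linearDl, linearDr, linearNl, linearNr) /=; ring.
Qed.

(** Let [d] be the common distance and [m] the midpoint of [p] and [q]. The parallelogram law at
    [x - p] and [x - q] gives [4 |x - m|^2 + |q - p|^2 = 4 d^2], and [m] in [C] forces
    [|x - m| >= d]. *)
Lemma nearest_point_unique (C : set X) (x p q : X) :
  (forall u v, C u -> C v -> C (2^-1 *: (u + v))) ->
  C p -> (forall y, C y -> `|x - p| <= `|x - y|) ->
  C q -> (forall y, C y -> `|x - q| <= `|x - y|) -> p = q.
Proof using dot dot_norm.
move=> midC Cp minp Cq minq.
have d_eq : `|x - q| = `|x - p|.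
  by apply/eqP; rewrite eq_le minq// minp.
have pq_sub : (x - p) - (x - q) = q - p.
  by rewrite opprB addrC addrA addrNK.
have pq_add : (x - p) + (x - q) = 2 *: (x - 2^-1 *: (p + q)).
  rewrite scalerBr scalerA mulfV// scale1r scaler_nat mulr2n opprD.
  by rewrite addrACA.
have := parallelogram (x - p) (x - q).
rewrite pq_sub pq_add normrZ d_eq (ger0_norm (ler0n _ _)) => E.
have le_mid := minp _ (midC _ _ Cp Cq).
have : `|q - p| ^+ 2 <= 0.
  have := ler_pM (normr_ge0 _) (normr_ge0 _) le_mid le_mid; rewrite -!expr2.
  by move: E; rewrite exprMn; lra.
rewrite le_eqVlt ltNge sqr_ge0 orbF sqrf_eq0 normr_eq0 subr_eq0.
by move/eqP.
Qed.

(* When no nearest point exists, both sides are equal to [x]. *)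
Lemma projector_translate (C D : set X) (p x : X) :
  (forall u v, C u -> C v -> C (2^-1 *: (u + v))) ->
  (forall y, D y <-> C (y - p)) ->
  projector D x = projector C (x - p) + p.
Proof using dot dot_norm.
move=> midC DC; rewrite /projector.
set N := [set q | C q /\ _]; set M := [set q | D q /\ _].
have MN q : M q <-> N (q - p).
  split=> -[Cq minq]; split; [exact/DC| |exact/DC|] => y Cy.
    have -> : x - p - (q - p) = x - q by rewrite opprB addrA addrNK.
    have -> : x - p - y = x - (y + p) by rewrite opprD addrAC addrA.
    by apply: minq; apply/DC; rewrite addrK.
  have -> : x - q = x - p - (q - p) by rewrite opprB addrA addrNK.
  have -> : x - y = x - p - (y - p) by rewrite opprB addrA addrNK.
  exact/minq/DC.
have [[q Nq]|noN] := pselect (exists q, N q); last first.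
  rewrite !xgetPN ?addrNK// => q Nq; first by apply: noN; exists q.
  by apply: noN; exists (q - p); exact/MN.
have Mq : M (q + p) by apply/MN; rewrite addrK.
have [Cxget minxget] : N (xget (x - p) N) by apply: xgetI Nq.
have /MN [Cxget' minxget'] : M (xget x M) by apply: xgetI Mq.
(* Each [xget] makes an arbitrary choice, so only uniqueness of the nearest point identifies the
   two. *)
apply/eqP; rewrite -subr_eq; apply/eqP.
exact: nearest_point_unique midC Cxget' minxget' Cxget minxget.
Qed.

End NearestPoint.

Lemma iter_linear (R : pzRingType) (V : lmodType R) (L : {linear V -> V}) n :
  linear (iter n L).
Proof.
by elim: n => [|n IHn] a u v //=; rewrite IHn linearP.
Qed.

Lemma ler_norm_iter (R : realType) (X : normedModType R) (L : {linear X -> X})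
    n x : nonexpansive L -> `|iter n L x| <= `|x|.
Proof.
move=> neL; elim: n => //= n; apply: le_trans.
by have := neL (iter n L x) 0; rewrite linear0 !subr0.
Qed.

Lemma iter_affine (R : pzRingType) (V : lmodType R) (L : {linear V -> V})
    (b p : V) (T : V -> V) n x :
  (forall x, T x = L x + b) -> T p = p -> iter n T x = iter n L (x - p) + p.
Proof.
move=> TE Tp; elim: n => [|n /= ->] /=; first by rewrite addrNK.
by rewrite TE linearD -addrA -TE Tp.
Qed.

Lemma cvg_linearly_cvg (R : realType) (Y : normedModType R) (mu : R)
    (y : nat -> Y) (l : Y) :
  0 < mu -> mu < 1 -> cvg_linearly mu y l -> y @ \oo --> l.
Proof.
move=> mu0 mu1 [M M0 yl]; apply/subr_cvg0; apply: norm_cvg0.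
apply: (@squeeze_cvgr _ _ _ _ (cst 0) (geometric M mu)).
- by near=> n; rewrite normr_ge0 yl.
- exact: cvg_cst.
- by apply: cvg_geometric; rewrite gtr0_norm.
Unshelve. all: by end_near. Qed.

Lemma bounded_operatorB (R : realType) (X : normedModType R) (A B : X -> X) :
  bounded_operator A -> bounded_operator B -> bounded_operator (A \- B).
Proof.
move=> [linA [M AM]] [linB [N BN]]; split.
  by move=> a u v /=; rewrite linA linB scalerBr opprD addrACA.
exists (M + N) => x; rewrite mulrDl (le_trans (ler_normB _ _))//.
by rewrite lerD.
Qed.

Lemma opnormP (R : realType) (X : normedModType R) (A : X -> X) x :
  bounded_operator A -> `|A x| <= opnorm A * `|x|.
Proof.
move=> [linA [M AM]].
pose Al : {linear X -> X} := HB.pack A (GRing.isLinear.Build _ _ _ _ _ linA).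
have A0 : A 0 = 0 := linear0 Al.
have AZ a u : A (a *: u) = a *: A u := linearZZ Al a u.
have [->|x0] := eqVneq x 0; first by rewrite A0 !normr0 mulr0.
have nx : 0 < `|x| by rewrite normr_gt0.
rewrite -ler_pdivrMr//; apply: ub_le_sup.
  (* The set under [sup] must be bounded above. The sign of [M] is unknown, and [|y| <= 1] bounds
     [M * |y|] by [M] only for nonnegative [M]. *)
  exists (Num.max M 0) => _ [y /= y1 <-]; apply: le_trans (AM y) _.
  apply: (@le_trans _ _ (Num.max M 0 * `|y|)).
    by rewrite ler_wpM2r// le_max lexx.
  by rewrite ler_piMr// le_max lexx orbT.
exists (`|x|^-1 *: x) => /=.
  by rewrite normrZ normfV normr_id mulVf// normr_eq0.
by rewrite AZ normrZ normfV normr_id mulrC.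
Qed.

Lemma opnorm_le (R : realType) (X : normedModType R) (A : X -> X) (M : R) :
  (forall x, `|x| <= 1 -> `|A x| <= M) -> opnorm A <= M.
Proof.
move=> AM; apply: ge_sup; last by move=> _ [x /= x1 <-]; exact: AM.
(* A supremum is bounded this way only over a nonempty set; the zero vector provides a member. *)
by exists `|A 0|; exists 0 => //=; rewrite normr0.
Qed.

Section UniformRate.
Variables (R : realType) (X : completeNormedModType R) (mu : R).
Hypotheses (mu_gt0 : 0 < mu) (mu_lt1 : mu < 1).
Variables (A_ : nat -> X -> X) (A : X -> X).
Hypothesis A_lin : forall n, linear (A_ n).
Hypothesis A_contr : forall n x, `|A_ n x| <= `|x|.
Hypothesis A_cvg : cvg_linearly_pointwise mu A_ A.

Let A_cvgn x : A_ n x @[n --> \oo] --> A x.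
Proof. exact: cvg_linearly_cvg mu_gt0 mu_lt1 (A_cvg x). Qed.

(** Linearity passes to the limit by uniqueness of limits. Taking [A] to be [projector (Fixset L)]
    yields linearity of that nearest-point map without projection theory. *)
Lemma pointwise_limit_linear : linear A.
Proof using mu_gt0 mu_lt1 A_lin A_cvg.
move=> a u v; apply: norm_cvg_unique (@A_cvgn (a *: u + v)) _.
have -> : (fun n => A_ n (a *: u + v)) = (fun n => a *: A_ n u + A_ n v).
  by apply/funext => n; rewrite A_lin.
by apply: cvgD; [apply: cvgZr|]; exact: A_cvgn.
Qed.

Lemma pointwise_limit_contr x : `|A x| <= `|x|.
Proof using mu_gt0 mu_lt1 A_contr A_cvg.
have normA : `|A_ n x| @[n --> \oo] --> `|A x|.
  by apply: cvg_norm; exact: A_cvgn.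
rewrite -(cvg_lim (@Rhausdorff R) normA).
apply: limr_le; first exact: cvgP normA.
by near=> n; exact: A_contr.
Unshelve. all: by end_near. Qed.

Lemma cvg_linearly_pointwise_opnorm : cvg_linearly_opnorm mu A_ A.
Proof using mu_gt0 mu_lt1 A_lin A_contr A_cvg.
have A_bnd n : bounded_operator (A_ n).
  by split=> //; exists 1 => x; rewrite mul1r.
have Abnd : bounded_operator A.
  split; first exact: pointwise_limit_linear.
  by exists 1 => x; rewrite mul1r pointwise_limit_contr.
split=> //.
pose B n x := mu ^- n *: (A_ n x - A x).
have normB n x : `|B n x| = mu ^- n * `|A_ n x - A x|.
  by rewrite normrZ gtr0_norm// invr_gt0 exprn_gt0.
(* Completeness of [X] enters here. The radius [1] asks for a uniform bound on the unit ball, where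
   [opnorm] is computed. *)
have [|x|M BM] := @Banach_Steinhauss _ _ _ (range B) _ _ 1.
- move=> _ [n _ <-]; split.
    (* This bound is for a single operator, so it may depend on [n]. *)
    move=> r; exists (mu ^- n * (r + r)) => x xr; rewrite normB.
    rewrite ler_pM2l ?invr_gt0 ?exprn_gt0// (le_trans (ler_normB _ _))// lerD//.
      exact: le_trans (A_contr _ _) xr.
    exact: le_trans (pointwise_limit_contr _) xr.
  move=> a u v; rewrite /B A_lin pointwise_limit_linear opprD addrACA -scalerBr.
  by rewrite scalerDr !scalerA mulrC.
(* Pointwise boundedness of the rescaled family at [x] is exactly the linear rate at [x], with the
   same constant. *)
- have [M _ AM] := A_cvg x; exists M => _ [n _ <-].
  by rewrite normB ler_pdivrMl ?exprn_gt0// mulrC.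
exists (Num.max M 0) => [|n]; first by rewrite le_max lexx orbT.
apply: opnorm_le => x x1 /=.
rewrite mulrC -ler_pdivrMl ?exprn_gt0// -normB le_max BM//.
Qed.

End UniformRate.

Lemma cvg_linearly_opnorm_pointwise (R : realType) (X : normedModType R)
    (mu : R) (A_ : nat -> X -> X) (A : X -> X) :
  cvg_linearly_opnorm mu A_ A -> cvg_linearly_pointwise mu A_ A.
Proof.
move=> [A_bnd Abnd [M M0 AM]] x; exists (M * `|x|) => [|n].
  by rewrite mulr_ge0.
have := opnormP x (bounded_operatorB (A_bnd n) Abnd); move/le_trans; apply.
by rewrite mulrAC ler_wpM2r.
Qed.

Lemma cvg_linearly_pointwise_affine (R : realType) (X : normedModType R)
    (dot : {dot X for idfun}) (L : {linear X -> X}) (b : X) (T : X -> X)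
    (mu : R) :
  induces_norm dot -> (forall x, T x = L x + b) -> Fixset T !=set0 ->
  cvg_linearly_pointwise mu (fun n => iter n T) (projector (Fixset T)) <->
  cvg_linearly_pointwise mu (fun n => iter n L) (projector (Fixset L)).
Proof.
move=> dot_norm TE [p Tp].
have midL u v : Fixset L u -> Fixset L v -> Fixset L (2^-1 *: (u + v)).
  by rewrite /Fixset /= linearZ linearD => -> ->.
have FixTL y : Fixset T y <-> Fixset L (y - p).
  rewrite /Fixset /= linearB.
  have -> : L y - L p = T y - p.
    by rewrite -[in RHS]Tp !TE [L p + b]addrC addrKA.
  by split=> [->//|/addIr].
(* The shifts by [p] cancel, so the two errors coincide and the same constant [M] serves in both
   directions. *)
have residual n x : iter n T x - projector (Fixset T) x =
    iter n L (x - p) - projector (Fixset L) (x - p).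
  rewrite (projector_translate dot_norm x midL FixTL) (iter_affine n x TE Tp).
  by rewrite [_ (x - p) + p]addrC addrKA.
split=> cv x.
  have [M M0 TM] := cv (x + p); exists M => // n.
  by have := TM n; rewrite residual addrK.
have [M M0 LM] := cv (x - p); exists M => // n.
by rewrite residual.
Qed.

Theorem theorem3p5 (R : realType) (X : completeNormedModType R)
    (dot : {dot X for idfun}) (dot_norm : induces_norm dot)
    (L : {linear X -> X}) (L_nonexpansive : nonexpansive L)
    (b : X) (T : X -> X) (TE : forall x, T x = L x + b)
    (FixT : Fixset T !=set0)
    (mu : R) (mu_gt0 : 0 < mu) (mu_lt1 : mu < 1) :
  [<-> cvg_linearly_pointwise mu (fun n => iter n T) (projector (Fixset T));
       cvg_linearly_pointwise mu (fun n => iter n L) (projector (Fixset L));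
       cvg_linearly_opnorm mu (fun n => iter n L) (projector (Fixset L))].
Proof.
have affine := cvg_linearly_pointwise_affine mu dot_norm TE FixT.
tfae; first exact: (proj1 affine).
- move=> cvL; apply: cvg_linearly_pointwise_opnorm => //.
  + exact: iter_linear.
  + by move=> n x; exact: ler_norm_iter.
- by move=> cvL; apply/(proj2 affine)/cvg_linearly_opnorm_pointwise.
Qed.
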